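(* Let $G$ be a finite simple connected graph with at least one edge. Then $G$ induces a $2$-periodic Grover walk if and only if $G$ is isomorphic to $P_2$, the path with two vertices.
   Context: Graphs are finite and simple (no loops, no multiple edges). For a graph $G$ with $m=|E(G)|$ edges, let $D(G)$ be the set of symmetric arcs of $G$: each edge $\{u,v\}\in E(G)$ gives the two arcs $(u,v)$ and $(v,u)$, so $|D(G)|=2m$. For an arc $e=(u,v)$ write $o(e)=u$, $t(e)=v$, $e^{-1}=(v,u)$. The Grover transfer matrix of $G$ is the $2m\times 2m$ matrix $U=U(G)=(U_{e,f})_{e,f\in D(G)}$ with $$U_{e,f}=\begin{cases}2/\deg(t(f)) & \text{if } t(f)=o(e) \text{ and } f\neq e^{-1},\\ 2/\deg(t(f))-1 & \text{if } f=e^{-1},\\ 0 & \text{otherwise.}\end{cases}$$ For a positive integer $k$, $G$ is said to induce a $k$-periodic Grover walk if $U^k=I_{2m}$ and $U^j\neq I_{2m}$ for every integer $j$ with $1\le j<k$. *)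

(* Defs.v *)
From mathcomp Require Import all_boot all_order all_algebra.

Set Implicit Arguments.
Unset Strict Implicit.
Unset Printing Implicit Defensive.

Import Order.TTheory GRing.Theory Num.Theory.
Local Open Scope ring_scope.

Record sgraph := SGraph {
  vertex :> finType;
  adj : rel vertex;
  adj_sym : symmetric adj;
  adj_irrefl : irreflexive adj
}.

Definition deg (G : sgraph) (v : G) : nat := #|[set w : G | adj v w]|.

Definition connected (G : sgraph) : Prop :=
  (0 < #|G|)%N /\ forall u v : G, connect (@adj G) u v.

Definition graph_iso (G H : sgraph) : Prop :=
  exists2 h : G -> H, bijective h & {mono h : u v / adj u v}.

Section PathGraph.
Variable n : nat.

Definition path_adj (i j : 'I_n) : bool := (i.+1 == j) || (j.+1 == i).

Lemma path_adj_sym : symmetric path_adj.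
Proof. by move=> i j; rewrite /path_adj orbC. Qed.

Lemma path_adj_irrefl : irreflexive path_adj.
Proof. by move=> i; rewrite /path_adj orbb eqn_leq ltnn. Qed.

Definition path_graph : sgraph := SGraph path_adj_sym path_adj_irrefl.

End PathGraph.

Section GroverWalk.
Variable G : sgraph.

Definition arc : Type := {p : G * G | adj p.1 p.2}.

Definition origin (e : arc) : G := (val e).1.
Definition terminus (e : arc) : G := (val e).2.

Lemma arc_rev_subproof (e : arc) : adj (terminus e) (origin e).
Proof. by rewrite adj_sym; exact: valP e. Qed.

Definition arc_rev (e : arc) : arc :=
  exist (fun p : G * G => adj p.1 p.2)
    (terminus e, origin e) (arc_rev_subproof e).

Variable R : numFieldType.

Definition grover_entry (e f : arc) : R :=
  if f == arc_rev e then 2 / (deg (terminus f))%:R - 1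
  else if terminus f == origin e then 2 / (deg (terminus f))%:R
  else 0.

Definition grover_matrix : 'M[R]_#|{: arc}| :=
  \matrix_(i, j) grover_entry (enum_val i) (enum_val j).

Definition periodic_grover_walk (k : nat) : Prop :=
  [/\ (0 < k)%N,
      grover_matrix ^+ k = 1%:M
    & forall j : nat, (1 <= j < k)%N -> grover_matrix ^+ j <> 1%:M].

End GroverWalk.

(* Main.v *)
Require Import Defs.
From mathcomp Require Import all_boot all_order all_algebra.

(** In a simple graph an arc is determined by its endpoints, so two consecutive
    arcs [f], [a] followed by [e] contribute the only term of the entry of [U^2]
    at [(e, f)]. If some vertex [v] had two neighbours [u <> w], the walk
    [u -> v -> w -> x] would give an off-diagonal entry
    [U_{(w,x),(v,w)} * 2 / deg v], nonzero for [x = v] unless [deg w = 2], and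
    in that case nonzero for the other neighbour [x] of [w]. So [U^2 = 1] forces
    all degrees to be at most 1; conversely [U] is then the arc reversal. *)

Set Implicit Arguments.
Unset Strict Implicit.
Unset Printing Implicit Defensive.

Import GRing.Theory Num.Theory.
Local Open Scope ring_scope.

(* [path.arc] would otherwise shadow the arcs of a graph. *)
Local Notation arc := Defs.arc.

(** Phrased as uniqueness of neighbours rather than through [deg], so that it transports directly
    along an isomorphism. *)
Definition degree_le1 (G : sgraph) : Prop :=
  forall u v w : G, adj u v -> adj u w -> v = w.

Section Arcs.
Variable G : sgraph.
Implicit Types (u v : G) (e f : arc G).

Definition mk_arc u v (uv : adj u v) : arc G :=
  exist (fun p : G * G => adj p.1 p.2) (u, v) uv.

Lemma arc_eqP e f :
  origin e = origin f -> terminus e = terminus f -> e = f.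
Proof.
move=> eq_o eq_t; apply: val_inj.
by rewrite [val e]surjective_pairing [val f]surjective_pairing; congr pair.
Qed.

Lemma arc_revK : involutive (@arc_rev G).
Proof. by move=> e; apply: arc_eqP. Qed.

Lemma arc_rev_neq e : arc_rev e != e.
Proof.
apply/eqP=> /(congr1 (@origin G)) /= te; have := valP e.
by rewrite -/(origin e) -/(terminus e) -te /= adj_irrefl.
Qed.

Lemma deg_gt0 u v : adj u v -> (0 < deg u)%N.
Proof. by move=> uv; apply/card_gt0P; exists v; rewrite inE. Qed.

Lemma deg2_other u v : deg u = 2%N -> exists2 w, adj u w & w != v.
Proof.
move=> /eqP/cards2P[x [y [neq_xy def_N]]].
have in_N z : adj u z = (z == x) || (z == y).
  by rewrite -in_set2 -def_N inE.
have [eq_xv | neq_xv] := eqVneq x v.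
  by exists y; rewrite ?in_N ?eqxx ?orbT // -eq_xv eq_sym.
by exists x; rewrite ?in_N ?eqxx.
Qed.

Lemma degree_le1_deg u v : degree_le1 G -> adj u v -> deg u = 1%N.
Proof.
move=> G1 uv; apply/eqP/cards1P; exists v; apply/setP=> w; rewrite !inE.
by apply/idP/eqP=> [uw | -> //]; apply: G1 uw uv.
Qed.

End Arcs.

Section GroverEntries.
Variables (G : sgraph) (R : numFieldType).
Implicit Types e f a : arc G.

Local Notation U := (grover_matrix G R).
Local Notation entry := (@grover_entry G R).

Lemma grover_entry_neq0 e f : entry e f != 0 -> terminus f = origin e.
Proof.
rewrite /grover_entry; have [-> // | _] := eqVneq f (arc_rev e).
by have [|_] := eqVneq (terminus f); rewrite ?eqxx.
Qed.

Lemma deg_terminus_neq0 f : (deg (terminus f))%:R != 0 :> R.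
Proof. by rewrite pnatr_eq0 -lt0n; apply: deg_gt0 (valP (arc_rev f)). Qed.

Lemma grover_entry_forward e f :
  terminus f = origin e -> f != arc_rev e -> entry e f != 0.
Proof.
move=> fe neq_fe; rewrite /grover_entry (negPf neq_fe) fe eqxx.
by rewrite mulf_neq0 ?pnatr_eq0 // invr_neq0 // -fe deg_terminus_neq0.
Qed.

Lemma grover_entry_back e :
  (deg (origin e) != 2)%N -> entry e (arc_rev e) != 0.
Proof.
move=> deg_n2; rewrite /grover_entry eqxx subr_eq0.
(* The back entry is [2 / deg - 1]; in characteristic 0 it vanishes only for degree 2. *)
apply: contra deg_n2 => /eqP/divr1_eq two_deg.
by rewrite eq_sym -(eqr_nat R) two_deg.
Qed.

(** If [f] leads into [e], then [origin f] and [terminus e] are neighbours of the same vertex, hence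
    equal: only reversal remains, with weight [2 / 1 - 1 = 1]. *)
Lemma grover_entry_degree_le1 e f :
  degree_le1 G -> entry e f = (f == arc_rev e)%:R.
Proof.
move=> G1; rewrite /grover_entry; case: eqP => [-> | neq_fe].
  by rewrite (degree_le1_deg G1 (valP e)) divr1 addrK.
case: eqP => // fe; case: neq_fe; apply: arc_eqP => //=.
by apply: G1 (valP (arc_rev f)) _; rewrite /= fe; apply: valP e.
Qed.

Lemma grover_sqrE e f :
  (U ^+ 2) (enum_rank e) (enum_rank f) = \sum_(a : arc G) entry e a * entry a f.
Proof.
rewrite expr2 mxE (reindex (@enum_rank (arc G))) /=; last first.
  by apply: onW_bij; apply: enum_rank_bij.
by apply: eq_bigr => a _; rewrite !mxE !enum_rankK.
Qed.

Lemma grover_sqr_path e a f :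
    terminus f = origin a -> terminus a = origin e ->
  (U ^+ 2) (enum_rank e) (enum_rank f) = entry e a * entry a f.
Proof.
move=> fa ae; rewrite grover_sqrE (bigD1 a) //= big1 ?addr0 // => b neq_ba.
apply: contra_neq_eq neq_ba; rewrite mulf_eq0 negb_or.
case/andP=> /grover_entry_neq0 be /grover_entry_neq0 fb.
by apply: arc_eqP; rewrite ?be // -fb.
Qed.

Lemma periodic2_degree_le1 : periodic_grover_walk G R 2 -> degree_le1 G.
Proof.
case=> _ U2 _ v u w vu vw; apply/eqP; apply: contraT => neq_uw.
have uv : adj u v by rewrite adj_sym.
have wv : adj w v by rewrite adj_sym.
pose f := mk_arc uv; pose a := mk_arc vw.
have af_neq0 : entry a f != 0.
  by apply: grover_entry_forward => //; apply: contra neq_uw => /eqP [->].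
(* The arcs [e] and [f] start at [w] and [u], which differ, so this entry of [U ^+ 2] is off the
   diagonal; its factor [entry a f] is nonzero. *)
have ea_eq0 e : w = origin e -> entry e a = 0.
  move=> we; apply/eqP; have := grover_sqr_path (erefl : terminus f = origin a) we.
  rewrite U2 mxE (inj_eq enum_rank_inj); case: eqP => [ef | _] /esym/eqP.
    by rewrite we ef eqxx in neq_uw.
  by rewrite mulf_eq0 (negPf af_neq0) orbF.
(* Some arc [e] out of [w] contradicts [ea_eq0]: the one back to [v], or the one to the second
   neighbour of [w] when the back entry vanishes. *)
have [deg_w | deg_w] := eqVneq (deg w) 2%N; last first.
  have := @grover_entry_back (mk_arc wv) deg_w.
  have -> : arc_rev (mk_arc wv) = a by apply: arc_eqP.
  by rewrite ea_eq0 ?eqxx.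
have [x wx neq_xv] := deg2_other v deg_w.
have : entry (mk_arc wx) a != 0.
  by apply: grover_entry_forward => //; apply: contra neq_xv => /eqP [->].
by rewrite ea_eq0 ?eqxx.
Qed.

(** The arc excludes period 1: over an empty set of arcs [U] would already be the identity. *)
Lemma degree_le1_periodic2 :
  degree_le1 G -> arc G -> periodic_grover_walk G R 2.
Proof.
move=> G1 e0; split=> // [|[|[|j]] // _].
  apply/matrixP=> i j; rewrite -(enum_valK i) -(enum_valK j) grover_sqrE.
  rewrite (bigD1 (arc_rev (enum_val i))) //= big1 ?addr0 => [|a neq_a].
    rewrite !grover_entry_degree_le1 // eqxx mul1r arc_revK mxE.
    by rewrite (inj_eq enum_rank_inj) eq_sym.
  by rewrite !grover_entry_degree_le1 // (negPf neq_a) mul0r.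
(* No arc is its own reverse, so the diagonal of [U] is zero. *)
rewrite expr1 => /matrixP/(_ (enum_rank e0) (enum_rank e0))/eqP.
rewrite !mxE enum_rankK grover_entry_degree_le1 // eqxx [e0 == _]eq_sym.
by rewrite (negPf (arc_rev_neq e0)) eq_sym oner_eq0.
Qed.

End GroverEntries.

Lemma degree_le1_iso_path2 (G : sgraph) (u v : G) :
  connected G -> adj u v -> degree_le1 G -> graph_iso G (path_graph 2).
Proof.
move=> [_ Gconn] uv G1.
have vu : adj v u by rewrite adj_sym.
have neq_vu : v != u by apply: contraTneq uv => ->; rewrite adj_irrefl.
have uvP x : (x == u) || (x == v).
  (* Each of [u], [v] has the other as its only neighbour, so by connectedness the pair exhausts
     [G]. *)
  have cl : closed (@adj G) (pred2 u v).
    apply: intro_closed => [|y z yz /pred2P[] def_y].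
    - exact/sym_connect_sym/adj_sym.
    - by rewrite def_y in yz; rewrite inE /= (G1 _ _ _ yz uv) eqxx orbT.
    - by rewrite def_y in yz; rewrite inE /= (G1 _ _ _ yz vu) eqxx.
  by have := closed_connect cl (Gconn u x); rewrite !inE eqxx /= => <-.
pose h x : path_graph 2 := if x == u then ord0 else ord_max.
pose g (i : path_graph 2) := if i == ord0 then u else v.
exists h.
  exists g => [x | i]; rewrite /h /g.
    by case/orP: (uvP x) => /eqP->; rewrite ?eqxx // (negPf neq_vu).
  by case: i => [[|[|i]] lti] //; rewrite /= ?eqxx ?(negPf neq_vu); apply: val_inj.
move=> x y; rewrite /h.
by case/orP: (uvP x) (uvP y) => /eqP-> /orP[] /eqP->;
  rewrite ?eqxx ?(negPf neq_vu) ?adj_irrefl ?uv ?vu.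
Qed.

Lemma degree_le1_path2 : degree_le1 (path_graph 2).
Proof.
by do 3!case=> [[|[|?]] ?] //; move=> // *; apply: val_inj.
Qed.

Lemma degree_le1_iso (G H : sgraph) :
  graph_iso G H -> degree_le1 H -> degree_le1 G.
Proof.
case=> h /bij_inj h_inj h_mono H1 u v w uv uw; apply: h_inj.
by apply: (H1 (h u)); rewrite h_mono.
Qed.

Theorem theorem2p1 (R : numFieldType) (G : sgraph)
    (Gconn : connected G) (Gedge : exists u v : G, adj u v) :
  periodic_grover_walk G R 2 <-> graph_iso G (path_graph 2).
Proof.
have [u [v uv]] := Gedge; split=> [/periodic2_degree_le1 | G_P2].
  exact: degree_le1_iso_path2 uv.
exact: degree_le1_periodic2 (degree_le1_iso G_P2 degree_le1_path2) (mk_arc uv).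
Qed.
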